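(* Let $K$ be a field of characteristic different from $2$, let $k$ be any positive odd integer, and let $h\in\mathbb{N}$ (a positive integer). Then $$S^k(h\times\mathbb{H})\simeq\frac{1}{2}\binom{2h+k-1}{k}\times\mathbb{H}.$$
   Context: $K$ is a field with $\mathrm{char}(K)\neq 2$, and symmetric bilinear forms over $K$ are identified with quadratic forms. $\langle a_1,\dots,a_m\rangle$ denotes the diagonal form with coefficients $a_i\in K^{\times}$. $\mathbb{H}=\langle 1,-1\rangle$ is the hyperbolic plane. For $r\ge 0$, $r\times\varphi$ denotes the orthogonal sum of $r$ copies of $\varphi$. $\perp$ denotes orthogonal sum and $\simeq$ denotes isometry. (Non-factorial) symmetric power: for $\varphi\simeq\langle a_1,\dots,a_m\rangle$ and an integer $k\ge 0$, the $k$-fold symmetric power $S^k\varphi$ is the diagonal form on the $k$-th symmetric power $S^kV$ of the underlying space $V$ given by the orthogonal sum of the one-dimensional forms $\langle a_{i_1}^{k_{i_1}}\cdots a_{i_\ell}^{k_{i_\ell}}\rangle$ over all choices of indices $1\le i_1<\dots<i_\ell\le m$ and positive integers $k_{i_1},\dots,k_{i_\ell}$ with $k_{i_1}+\dots+k_{i_\ell}=k$. That is, there is one summand for each degree-$k$ monomial in $a_1,\dots,a_m$. In particular $S^0\varphi=\langle 1\rangle$, $S^1\varphi=\varphi$ and $\dim S^k\varphi=\binom{m+k-1}{k}$. Up to isometry $S^k\varphi$ depends only on the isometry class of $\varphi$. *)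

(* Defs.v *)
From HB Require Import structures.
From mathcomp Require Import all_boot all_order all_algebra.

Set Implicit Arguments.
Unset Strict Implicit.
Unset Printing Implicit Defensive.

Import GRing.Theory.
Local Open Scope ring_scope.

(* A sequence [:: a_1; ...; a_m] of scalars stands for the diagonal form
   <a_1, ..., a_m>; [diag_form a] is the symmetric bilinear form itself, on the
   space K^m of row vectors. *)
Definition diag_form (K : fieldType) (a : seq K) (u v : 'rV[K]_(size a)) : K :=
  \sum_(i < size a) a`_i * u 0 i * v 0 i.

Definition isometric (K : fieldType) (a b : seq K) : Prop :=
  exists f : {linear 'rV[K]_(size a) -> 'rV[K]_(size b)},
    bijective f /\
    forall u v, diag_form (f u) (f v) = diag_form u v.

Definition hyperbolic_plane (K : fieldType) : seq K := [:: 1; -1].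

(* Orthogonal sum of diagonal forms is concatenation of coefficients. *)
Definition copies (K : fieldType) (r : nat) (a : seq K) : seq K :=
  flatten (nseq r a).

(* A degree-k monomial in m variables, given by its exponents; an exponent is
   at most k, so that there are finitely many candidates. A choice of indices
   i_1 < ... < i_l with positive exponents is the support of the monomial. *)
Definition monomials (m k : nat) : seq {ffun 'I_m -> 'I_k.+1} :=
  [seq e : {ffun 'I_m -> 'I_k.+1} <- enum {: {ffun 'I_m -> 'I_k.+1}}
     | \sum_(i < m) e i == k]%N.

Definition sym_power (K : fieldType) (k : nat) (a : seq K) : seq K :=
  [seq \prod_(i < size a) a`_i ^+ e i
     | e : {ffun 'I_(size a) -> 'I_k.+1} <- monomials (size a) k].

(* Main.v *)
Require Import Defs.
From mathcomp Require Import all_boot all_order all_algebra.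
From mathcomp Require Import perm zify.

Set Implicit Arguments.
Unset Strict Implicit.
Unset Printing Implicit Defensive.

Import GRing.Theory.
Local Open Scope ring_scope.

(** Diagonalize [h x H] as [<1, -1, 1, -1, ...>], with [n = 2h] coefficients
    [(-1) ^ i], [i < n].  The monomial with exponents [e] then contributes the
    one-dimensional form [<(-1) ^ w>], where [w = \sum_i i * e_i] is its weight
    ([weight]).  Reversing the order of the variables, [i |-> n - 1 - i],
    permutes the monomials of degree [k] and replaces [w] by [(n - 1) * k - w]
    ([weight_rev]).  Since [n] is even and [k] is odd, [(n - 1) * k] is odd, so
    this reversal exchanges the monomials of even weight with those of odd
    weight ([count_odd_weight]).  Hence among the ['C(n + k - 1, k)] diagonal
    entries of the symmetric power ([size_monomials]) exactly half are [1] and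
    half are [-1]: they are those of the required multiple of [H], up to order,
    and the order of the diagonal entries does not change the isometry class
    ([isometric_perm]). *)

Lemma isometric_reindex (K : fieldType) (a b : seq K)
    (f : 'I_(size a) -> 'I_(size b)) (g : 'I_(size b) -> 'I_(size a)) :
  cancel f g -> cancel g f -> (forall i : 'I_(size a), a`_i = b`_(f i)) -> isometric a b.
Proof.
move=> fK gK ab; exists (colsub g); split.
  by exists (colsub f) => u; apply/rowP => i; rewrite !mxE ?fK ?gK.
move=> u v; rewrite /diag_form (reindex f) /=; last by exists g => i _.
by apply: eq_bigr => i _; rewrite !mxE fK ab.
Qed.

Lemma isometric_perm (K : fieldType) (a b : seq K) :
  perm_eq a b -> isometric a b.
Proof.
move=> ab; have sz := perm_size ab.
have /tuple_permP[p Ea] : perm_eq a (in_tuple b) by [].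
pose f i := p (cast_ord sz i).
pose g i := cast_ord (esym sz) (p^-1%g i).
apply: (@isometric_reindex _ a b f g) => i.
- by rewrite /f /g permK cast_ordK.
- by rewrite /f /g cast_ordKV permKV.
have lt_i : (i < size b)%N by rewrite -sz.
rewrite {1}Ea -[nat_of_ord i]/(nat_of_ord (Ordinal lt_i)).
rewrite -tnth_nth tnth_mktuple (tnth_nth 0) /= /f.
by congr (b`_(p _)); apply: val_inj.
Qed.

Lemma size_copies (K : fieldType) (r : nat) (a : seq K) :
  size (copies r a) = (r * size a)%N.
Proof. by rewrite size_flatten /shape map_nseq sumn_nseq mulnC. Qed.

Lemma nth_copies_hyperbolic_plane (K : fieldType) (h i : nat) :
  (i < h * 2)%N -> (copies h (hyperbolic_plane K))`_i = (-1) ^+ i.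
Proof.
elim: h i => // h IHh [|[|i]] //= lt_i.
by rewrite !exprS mulrA mulN1r opprK mul1r -IHh.
Qed.

Section Monomials.

Variables m k : nat.
Implicit Type e : {ffun 'I_m -> 'I_k.+1}.

Lemma mem_monomials e : (e \in monomials m k) = (\sum_(i < m) e i == k)%N.
Proof. by rewrite mem_filter mem_enum andbT. Qed.

Lemma monomials_uniq : uniq (monomials m k).
Proof. by rewrite filter_uniq ?enum_uniq. Qed.

Definition weight e : nat := (\sum_(i < m) i * e i)%N.

Definition rev_monomial e : {ffun 'I_m -> 'I_k.+1} :=
  [ffun i => e (rev_ord i)].

Lemma rev_monomialK : involutive rev_monomial.
Proof. by move=> e; apply/ffunP => i; rewrite !ffunE rev_ordK. Qed.

Lemma rev_monomial_in e :
  (rev_monomial e \in monomials m k) = (e \in monomials m k).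
Proof.
rewrite !mem_monomials (reindex_inj rev_ord_inj) /=.
by under eq_bigr => i _ do rewrite ffunE rev_ordK.
Qed.

Lemma perm_rev_monomials :
  perm_eq (map rev_monomial (monomials m k)) (monomials m k).
Proof.
apply: uniq_perm; rewrite ?(map_inj_uniq (inv_inj rev_monomialK)) //.
- exact: monomials_uniq.
- exact: monomials_uniq.
move=> e; rewrite -{1}[e]rev_monomialK.
by rewrite (mem_map (inv_inj rev_monomialK)) rev_monomial_in.
Qed.

Lemma weight_rev e : e \in monomials m k ->
  (weight (rev_monomial e) + weight e = m.-1 * k)%N.
Proof.
rewrite mem_monomials => /eqP deg_e.
rewrite /weight (reindex_inj rev_ord_inj) -big_split /= -[in RHS]deg_e.
rewrite big_distrr /=; apply: eq_bigr => i _.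
rewrite ffunE rev_ordK -mulnDl; congr (_ * _)%N.
by have := ltn_ord i; lia.
Qed.

(** The weights of a monomial and of its reversal add up to [m.-1 * k], which is
    odd here, so the reversal is a bijection between the two parity classes. *)
Lemma count_odd_weight : ~~ odd m -> odd k ->
  count (odd \o weight) (monomials m k) =
  count (predC (odd \o weight)) (monomials m k).
Proof.
move=> m_even k_odd; rewrite -(seq.permP perm_rev_monomials) count_map.
apply: eq_in_count => e e_in /=.
have m_gt0 : (0 < m)%N.
  (* without variables there is only the monomial 1, of even degree *)
  case: (posnP m) => // m0; move: e_in k_odd; rewrite mem_monomials.
  by rewrite big1 => [/eqP <-//|i _]; have := ltn_ord i; lia.
have := congr1 odd (weight_rev e_in).
rewrite oddD oddM k_odd andbT -subn1 oddB // (negbTE m_even) /=.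
by case: (odd _); case: (odd _).
Qed.

End Monomials.

(** Stars and bars: the exponents are the parts of an ordered partition of [k]
    into [m] parts, possibly zero. *)
Lemma size_monomials (m k : nat) : (0 < m)%N ->
  size (monomials m k) = 'C(m + k - 1, k).
Proof.
case: m => // m _; rewrite addSn subn1 /= -[RHS]bin_sub ?leq_addl // addnK.
rewrite -card_ord_partitions -sum1dep_card.
rewrite -(card_uniqP (monomials_uniq m.+1 k)) -sum1_card.
pose f (t : m.+1.-tuple 'I_k.+1) := [ffun i => tnth t i].
rewrite (reindex f) /=; last first.
  exists (fun e : {ffun _} => [tuple e i | i < m.+1]) => t _.
    by apply: eq_from_tnth => i; rewrite tnth_mktuple ffunE.
  by apply/ffunP => i; rewrite ffunE tnth_mktuple.
apply: eq_bigl => t; rewrite mem_monomials big_tuple.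
by under eq_bigr => i _ do rewrite ffunE.
Qed.

(** Factoring the coefficients through booleans turns the comparison of the two
    diagonal forms into a count of parities. *)
Lemma sym_power_hyperbolic (K : fieldType) (h k : nat)
    (m := size (copies h (hyperbolic_plane K))) :
  sym_power k (copies h (hyperbolic_plane K)) =
  [seq (-1) ^+ nat_of_bool b
     | b <- [seq odd (weight e) | e <- monomials m k]].
Proof.
rewrite -map_comp; apply: eq_map => e /=.
rewrite signr_odd /weight expr_sum; apply: eq_bigr => i _.
rewrite nth_copies_hyperbolic_plane ?exprM //.
by rewrite -[(h * 2)%N](size_copies h (hyperbolic_plane K)).
Qed.

Lemma copies_hyperbolic_planeE (K : fieldType) (r : nat) :
  copies r (hyperbolic_plane K) =
  [seq (-1) ^+ nat_of_bool b | b <- flatten (nseq r [:: false; true])].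
Proof. by rewrite map_flatten map_nseq. Qed.

Lemma perm_balanced_bits (s : seq bool) :
  count id s = count negb s ->
  perm_eq s (flatten (nseq (size s %/ 2) [:: false; true])).
Proof.
move=> balanced; have size_s : size s = (count negb s).*2.
  by rewrite -(count_predC id s) balanced addnn.
have count_half b : count_mem b s = (size s %/ 2)%N.
  rewrite size_s -muln2 mulnK //.
  by case: b; [rewrite -balanced|]; apply: eq_count => -[].
rewrite /perm_eq; apply/allP => b _ /=; rewrite count_half.
by rewrite count_flatten map_nseq sumn_nseq; case: b; rewrite /= ?mul1n.
Qed.

Theorem proposition3p1 (K : fieldType) (charK : 2%N \notin [pchar K])
    (k : nat) (k_gt0 : (0 < k)%N) (k_odd : odd k) (h : nat) (h_gt0 : (0 < h)%N) :
  isometric (sym_power k (copies h (hyperbolic_plane K)))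
            (copies ('C(2 * h + k - 1, k) %/ 2) (hyperbolic_plane K)).
Proof.
apply: isometric_perm; rewrite sym_power_hyperbolic size_copies mulnC.
rewrite copies_hyperbolic_planeE; apply: perm_map.
rewrite -size_monomials ?muln_gt0 //.
rewrite -(size_map (odd \o @weight (2 * h) k)); apply: perm_balanced_bits.
by rewrite !count_map; apply: count_odd_weight; rewrite ?oddM.
Qed.
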